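(* Let $X, Y$ be separable metrizable spaces and let $f : X \rightarrow Y$ be a function. Then Player I has a winning strategy in the game $G(f)$ if and only if there exists a nonempty compact set $K \subseteq X$ such that the restriction $f{\upharpoonright}K : K \to Y$ has no points of continuity.
   Context: Convergent sequences of open sets: a sequence $(U_n)_{n\in\mathbb{N}}$ of open subsets of a topological space $X$ is convergent if it is decreasing with respect to $\subseteq$ and it is a local basis of some $x\in X$ (i.e. $x\in U_n$ for all $n$, and every open neighborhood of $x$ contains some $U_n$); in that case we write $\lim_{n\to\infty}U_n=x$ and say it converges to $x$. The game $G(f)$: let $X,Y$ be separable metrizable spaces and $f:X\to Y$. At round $n\in\mathbb{N}$, Player I plays a nonempty open subset $U_n$ of $X$, and then Player II plays a point $y_n\in\mathrm{ran}(f)$, with the rule that $U_{n+1}\subseteq U_n$ for every $n$. Player II wins the run if either the sequence $(U_n)_{n\in\mathbb{N}}$ is not convergent, or it converges to some $x\in X$ and $(y_n)_{n\in\mathbb{N}}$ converges to $f(x)$ in $Y$; otherwise Player I wins the run. Strategies: a partial play of Player II is a finite (possibly empty) sequence of elements of $\mathrm{ran}(f)$. A strategy for Player I is a function $\tau$ assigning to each partial play of Player II an open subset of $X$, respecting the rules of the game (the sets played are nonempty and decreasing along each play). It is winning if for every infinite sequence $(y_n)_{n\in\mathbb{N}}$ in $\mathrm{ran}(f)$, Player I wins the run in which at each round $n$ Player I plays $U_n=\tau(y_0,\dots,y_{n-1})$ (with $U_0=\tau(\emptyset)$) and Player II plays $y_n$. A point of continuity of $f{\upharpoonright}K$ is a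 point $x\in K$ at which $f{\upharpoonright}K$ is continuous, where $K$ carries the subspace topology. *)

(* Defs.v *)
From mathcomp Require Import all_boot all_order all_algebra.
From mathcomp Require Import all_classical all_reals all_analysis.

Set Implicit Arguments.
Unset Strict Implicit.
Unset Printing Implicit Defensive.

Import Order.TTheory GRing.Theory Num.Theory.

Local Open Scope classical_set_scope.
Local Open Scope ring_scope.

Definition is_metric (R : realType) (T : Type) (d : T -> T -> R) : Prop :=
  [/\ forall x y, 0 <= d x y,
      forall x y, d x y = 0 <-> x = y,
      forall x y, d x y = d y x &
      forall x y z, d x z <= d x y + d y z].

Definition metrizable (R : realType) (T : topologicalType) : Prop :=
  exists2 d : T -> T -> R, is_metric d &
    forall A : set T, open A <->
      (forall x, A x -> exists2 e : R, 0 < e & [set y | d x y < e] `<=` A).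

Definition separable (T : topologicalType) : Prop :=
  exists2 D : set T, countable D & dense D.

Definition open_seq_converges (X : topologicalType) (U : nat -> set X) (x : X)
    : Prop :=
  [/\ forall n, open (U n),
      forall n, U n.+1 `<=` U n,
      forall n, U n x &
      forall V, open V -> V x -> exists n, U n `<=` V].

Definition open_seq_convergent (X : topologicalType) (U : nat -> set X) : Prop :=
  exists x, open_seq_converges U x.

Section Game.
Variables (X Y : topologicalType) (f : X -> Y).

(* Moves of Player II live in the subtype [set_type (range f)] of Y. *)
Definition partial_play : Type := seq (set_type (range f)).

Definition playerII_wins (U : nat -> set X) (y : nat -> set_type (range f))
    : Prop :=
  ~ open_seq_convergent U \/
  exists x, open_seq_converges U x /\ (fun n => set_val (y n)) @ \oo --> f x.

Definition playerI_wins (U : nat -> set X) (y : nat -> set_type (range f))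
    : Prop :=
  ~ playerII_wins U y.

Definition playerI_strategy (tau : partial_play -> set X) : Prop :=
  [/\ forall s, open (tau s),
      forall s, tau s !=set0 &
      forall s y, tau (rcons s y) `<=` tau s].

(* [mkseq y n] is [:: y 0; ...; y n.-1], so U_0 = tau [::]. *)
Definition playerI_winning_strategy (tau : partial_play -> set X) : Prop :=
  playerI_strategy tau /\
  forall y : nat -> set_type (range f), playerI_wins (fun n => tau (mkseq y n)) y.

Definition playerI_has_winning_strategy : Prop :=
  exists tau, playerI_winning_strategy tau.

(* [subspace K] has carrier X, with the points outside K isolated, hence the
   side condition [K x]. *)
Definition restriction_continuity_point (K : set X) (x : X) : Prop :=
  K x /\ {for (x : subspace K), continuous (f : subspace K -> Y)}.

End Game.

(* Main.v *)
Require Import Defs.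
From mathcomp Require Import all_boot all_order all_algebra.
From mathcomp Require Import all_classical all_reals all_analysis.
From mathcomp Require Import lra.

Set Implicit Arguments.
Unset Strict Implicit.
Unset Printing Implicit Defensive.

Import Order.TTheory GRing.Theory Num.Theory.

Local Open Scope classical_set_scope.
Local Open Scope ring_scope.

(** Suppose first that [K] is a nonempty compact set on which [f] has no
    continuity point.  A Baire category argument ([uniform_oscillation]) gives
    a nonempty relatively open part of [K] on which the oscillation of the
    restriction of [f] is at least some [delta > 0] everywhere.  Player I stays
    in this part and plays shrinking neighbourhoods of a guessed limit.  Each
    time the answer of Player II comes within [delta / 4] of the image of the
    guess, the guess jumps to a nearby point of [K] whose image is at distance
    at least [delta].  If the answers converged to the image of the limit, then
    after finitely many rounds a jump would make the guess permanent, with an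
    image too far from the limit of the answers; and without jumps the answers
    would stay away from the image of the final guess
    ([compact_winning_strategy]).

    Conversely, let [tau] be a winning strategy and [D] a dense sequence in the
    range of [f].  Every play converges to a point, since otherwise Player II
    wins.  If the answer in round [n] is restricted to the first [n+1] terms of
    [D], the plays form a compact product of finite sets, and the limit depends
    continuously on the play, so the limits form a compact set [K]
    ([strategy_compact_limits]).  If [f] had a continuity point on every
    nonempty compact subset of [K], then [K] would, for each [e > 0], be covered
    by countably many closed sets with images of diameter at most [e]
    ([compact_countably_small]).  Such covers let Player II guess better and
    better where the limit lies and answer, within the restriction above, so
    that the answers converge to the image of the limit
    ([countably_small_reply]); this defeats [tau].  Restricting the answers to
    finitely many in each round costs nothing, because good approximations may
    be delayed. *)

(** * Metrizable spaces *)

Section Metric.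
Context {R : realType} {T : topologicalType} {d : T -> T -> R}.
Hypothesis d_metric : is_metric d.
Hypothesis d_open : forall A : set T, open A <->
  (forall x, A x -> exists2 e : R, 0 < e & [set y | d x y < e] `<=` A).

Lemma is_metric_ge0 x y : 0 <= d x y. Proof. by have [] := d_metric. Qed.

Lemma is_metric_eq0 x y : d x y = 0 <-> x = y.
Proof. by have [] := d_metric. Qed.

Lemma is_metric_refl x : d x x = 0. Proof. exact/is_metric_eq0. Qed.

Lemma is_metric_sym x y : d x y = d y x. Proof. by have [] := d_metric. Qed.

Lemma is_metric_triangle y x z : d x z <= d x y + d y z.
Proof. by have [] := d_metric. Qed.

Lemma open_is_metric_ball x e : open [set y | d x y < e].
Proof.
apply/d_open => y /= xy; exists (e - d x y); first by rewrite subr_gt0.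
by move=> z /= yz; have := is_metric_triangle y x z; lra.
Qed.

Lemma nbhs_is_metricP x (A : set T) :
  nbhs x A <-> exists2 e : R, 0 < e & [set y | d x y < e] `<=` A.
Proof.
split=> [|[e e0 eA]].
  rewrite nbhsE => -[V [Vo Vx] VA].
  by have [e e0 eV] := (d_open V).1 Vo x Vx; exists e => // y /eV /VA.
rewrite nbhsE; exists [set y | d x y < e] => //; split => /=.
  exact: open_is_metric_ball.
by rewrite is_metric_refl.
Qed.

Lemma is_metric_hausdorff : hausdorff_space T.
Proof.
move=> x y xy; apply/is_metric_eq0/eqP; rewrite eq_le is_metric_ge0 andbT leNgt.
apply/negP => d0; have h0 : 0 < d x y / 2 by rewrite divr_gt0.
have nx : nbhs x [set z | d x z < d x y / 2] by apply/nbhs_is_metricP; exists (d x y / 2).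
have ny : nbhs y [set z | d y z < d x y / 2] by apply/nbhs_is_metricP; exists (d x y / 2).
have [z /= [xz yz]] := xy _ _ nx ny.
by have := is_metric_triangle z x y; rewrite (is_metric_sym z y); lra.
Qed.

(** Every point of an open set has a neighbourhood of small diameter whose
    closure stays inside that open set. *)
Lemma small_open_nbhs (U : set T) x (e : R) : open U -> U x -> 0 < e ->
  exists V : set T, [/\ open V, V x, closure V `<=` U &
    forall y z, V y -> V z -> d y z < e].
Proof.
move=> Uo Ux e0; have [r r0 rU] := (d_open U).1 Uo x Ux.
pose s := Num.min (e / 2) (r / 2).
have s0 : 0 < s by rewrite lt_min !divr_gt0.
have [se sr] : s <= e / 2 /\ s <= r / 2.
  by split; rewrite /s ge_min lexx ?orbT.
exists [set y | d x y < s]; split.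
- exact: open_is_metric_ball.
- by rewrite /= is_metric_refl.
- move=> y /(_ [set z | d y z < r / 2]) [|z /= [xz yz]].
    by apply/nbhs_is_metricP; exists (r / 2) => //; rewrite divr_gt0.
  apply: rU => /=; have := is_metric_triangle z x y; rewrite (is_metric_sym z y); lra.
- move=> y z /= xy xz; have := is_metric_triangle x y z; rewrite (is_metric_sym y x); lra.
Qed.

Lemma is_metric_lt_inv_eq x y : (forall n, d x y < n.+1%:R^-1) -> x = y.
Proof.
move=> h; apply/is_metric_eq0/eqP; rewrite eq_le is_metric_ge0 andbT leNgt.
apply/negP => /ltr_add_invr [k]; rewrite add0r => hk.
by have := lt_trans hk (h k); rewrite ltxx.
Qed.

(** A separable metrizable space is second countable: balls of radius
    [1/(j+1)] around the points of a dense sequence form a base. *)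
Lemma separable_countable_base : separable T ->
  exists B : nat -> set T, (forall n, open (B n)) /\
    forall x U, open U -> U x -> exists n, B n x /\ B n `<=` U.
Proof.
move=> [D Dc Dd]; have [[x0 _]|T0] := pselect ([set: T] !=set0); last first.
  exists (fun=> setT); split=> [_|x]; first exact: openT.
  by case: T0; exists x.
have [p [_ Dp]] : [set: T] `&` D !=set0 by apply: Dd; [exists x0|exact: openT].
have [D0|[e]] := pfcard_geP Dc; first by move: Dp; rewrite D0.
have eD y : D y -> exists n, e n = y.
  by move=> /(@surj _ _ _ _ e) [n _ <-]; exists n.
pose ij n : nat * nat := odflt (0, 0)%N (unpickle n).
exists (fun n => [set y | d (e (ij n).1) y < (ij n).2.+1%:R^-1]); split.
  by move=> n; exact: open_is_metric_ball.
move=> x U Uo Ux; have [r r0 rU] := (d_open U).1 Uo x Ux.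
have [j] : exists j, 0 + j.+1%:R^-1 < r / 2 by apply: ltr_add_invr; rewrite divr_gt0.
rewrite add0r; set s := j.+1%:R^-1 => sr.
have s0 : 0 < s by rewrite invr_gt0.
have [y [/= xy /eD [i iy]]] : [set y | d x y < s] `&` D !=set0.
  by apply: Dd; [exists x => /=; rewrite is_metric_refl|exact: open_is_metric_ball].
exists (pickle (i, j)); rewrite /ij pickleK /= iy -/s; split.
  by rewrite is_metric_sym.
by move=> z /= yz; apply: rU => /=; have := is_metric_triangle y x z; lra.
Qed.

End Metric.

(** Along a decreasing sequence of open sets that all meet a compact set, and
    each of which contains the closure of the next one, some point of the
    compact set survives. *)
Lemma compact_nested_open (T : topologicalType) (K : set T) (A : nat -> set T) :
  compact K -> (forall n, closure (A n.+1) `<=` A n) ->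
  (forall n, A n `&` K !=set0) -> exists2 x, K x & forall n, A n x.
Proof.
move=> Kc cA AK; have [x xA] := choice AK.
have Adec n m : (n <= m)%N -> A m `<=` A n.
  move=> /subnK <-; elim: (m - n)%N => [//|k IH] z /subset_closure /cA.
  exact: IH.
have FK : (x @ \oo) K by exists 0%N => // n _; exact: (xA n).2.
have [p [Kp clp]] := Kc (x @ \oo) _ FK.
exists p => // n; apply: cA => B Bp.
have [|z] := clp (A n.+1) B _ Bp; last by exists z.
by exists n.+1 => // m /= nm; apply: Adec nm _ _; exact: (xA m).1.
Qed.

(** * Continuity of a restriction *)

Lemma restriction_continuity_pointP (R : realType) (X Y : topologicalType)
    (d : Y -> Y -> R) (f : X -> Y) (K : set X) (x : X) :
  is_metric d ->
  (forall A : set Y, open A <->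
    (forall y, A y -> exists2 e : R, 0 < e & [set z | d y z < e] `<=` A)) ->
  restriction_continuity_point f K x <-> K x /\ forall e : R, 0 < e ->
    exists V : set X, [/\ open V, V x & forall z, V z -> K z -> d (f x) (f z) < e].
Proof.
move=> dm dopen; split=> -[Kx fx]; split=> //.
  move=> e e0.
  have : nbhs (f x) [set z | d (f x) z < e] by apply/(nbhs_is_metricP dm dopen); exists e.
  move=> /fx; rewrite /nbhs /= -nbhs_subspace_in// nbhsE => -[V [Vo Vx] VK].
  by exists V; split=> // z Vz Kz; exact: VK.
move=> B /(nbhs_is_metricP dm dopen) [e e0 eB]; have [V [Vo Vx VK]] := fx e e0.
rewrite /nbhs /= -nbhs_subspace_in// nbhsE; exists V => // z Vz Kz.
exact/eB/VK.
Qed.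

(** * From a compact set without continuity points to a winning strategy *)

Section CompactToStrategy.
Context {R : realType} {X Y : topologicalType}.
Context {dX : X -> X -> R} {dY : Y -> Y -> R}.
Hypothesis dX_metric : is_metric dX.
Hypothesis dX_open : forall A : set X, open A <->
  (forall x, A x -> exists2 e : R, 0 < e & [set y | dX x y < e] `<=` A).
Hypothesis dY_metric : is_metric dY.
Hypothesis dY_open : forall A : set Y, open A <->
  (forall x, A x -> exists2 e : R, 0 < e & [set y | dY x y < e] `<=` A).
Variables (f : X -> Y) (K : set X).
Hypothesis K_compact : compact K.
Hypothesis K_neq0 : K !=set0.
Hypothesis K_discontinuous : forall x, ~ restriction_continuity_point f K x.

(** The Baire category step: on some nonempty relatively open part of [K] the
    oscillation of the restriction of [f] is bounded below by a single
    positive number.  Otherwise nested open sets on which [f] varies less and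
    less would shrink to a continuity point. *)
Lemma uniform_oscillation : exists (W : set X) (delta : R),
  [/\ open W, W `&` K !=set0, 0 < delta &
    forall x V, W x -> K x -> open V -> V x ->
      exists z, [/\ V z, K z & delta <= dY (f x) (f z)]].
Proof.
apply: contrapT => noW.
have next (p : set X * nat) : exists W : set X,
    open p.1 /\ p.1 `&` K !=set0 ->
    [/\ open W, W `&` K !=set0, closure W `<=` p.1 &
      forall y z, W y -> K y -> W z -> K z -> dY (f y) (f z) < p.2.+1%:R^-1].
  case: p => W n /=; have [[Wo WK]|nW] := pselect (open W /\ W `&` K !=set0);
    last by exists W => /nW.
  pose e : R := n.+1%:R^-1; have e0 : 0 < e by rewrite invr_gt0.
  apply: contrapT => noW'; apply: noW; exists W, (e / 2); split=> //.
    by rewrite divr_gt0.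
  move=> x V Wx Kx Vo Vx; apply: contrapT => noz; apply: noW'.
  have [W' [W'o W'x clW' _]] := small_open_nbhs dX_metric dX_open
    (openI Vo Wo) (conj Vx Wx) ltr01.
  have W'V z : W' z -> V z by move=> /subset_closure /clW' [].
  have small z : W' z -> K z -> dY (f x) (f z) < e / 2.
    move=> W'z Kz; rewrite ltNge; apply/negP => le; apply: noz.
    by exists z; split=> //; exact: W'V.
  exists W' => _; split=> //; first by exists x.
    by move=> z /clW' [].
  move=> y z W'y Ky W'z Kz; rewrite -/e.
  have := is_metric_triangle dY_metric (f x) (f y) (f z).
  have := small y W'y Ky; have := small z W'z Kz.
  by rewrite (is_metric_sym dY_metric (f y) (f x)); lra.
have {next} [next nextP] := choice next.
pose A := fix A n := if n is m.+1 then next (A m, m) else [set: X].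
have Aok n : open (A n) /\ A n `&` K !=set0.
  elim: n => [|n IH] /=; first by rewrite setTI; split=> //; exact: openT.
  by have [] := nextP (A n, n) IH.
have [||x Kx xA] := compact_nested_open (A := A) K_compact.
- by move=> n; have [] := nextP (A n, n) (Aok n).
- by move=> n; have [] := Aok n.
apply: (@K_discontinuous x).
apply/(restriction_continuity_pointP f K x dY_metric dY_open); split=> // e e0.
have [n] := ltr_add_invr e0; rewrite add0r => ne.
exists (A n.+1); split=> //; first by have [] := Aok n.+1.
move=> z Az Kz; apply: lt_trans ne.
by have [_ _ _] := nextP (A n, n) (Aok n); apply=> //; exact: xA n.+1.
Qed.

(** Player I guesses the limit point: the current guess is kept as long as the
    answers of Player II stay away from its image, and is replaced by a nearby
    point with a very different image as soon as they come close.  The state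
    after [n] rounds is the guess [st.1.1], the open set [st.1.2] just played
    and the round number [st.2]. *)
Lemma compact_winning_strategy : playerI_has_winning_strategy f.
Proof.
have [W [delta [Wo [x0 [Wx0 Kx0]] delta0 oscW]]] := uniform_oscillation.
pose eta := delta / 4; have eta0 : 0 < eta by rewrite divr_gt0.
have deltaE : delta = 4 * eta by rewrite /eta; lra.
pose inv (st : X * set X * nat) :=
  [/\ open st.1.2, st.1.2 st.1.1, K st.1.1 & st.1.2 `<=` W].
pose next (st : X * set X * nat) (y : Y) (st' : X * set X * nat) :=
  [/\ closure st'.1.2 `<=` st.1.2,
     (forall u v, st'.1.2 u -> st'.1.2 v -> dX u v < st.2.+1%:R^-1),
      st'.2 = st.2.+1,
      (eta <= dY y (f st.1.1) -> st'.1.1 = st.1.1) &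
      (dY y (f st.1.1) < eta -> delta <= dY (f st.1.1) (f st'.1.1))].
have nextE (p : (X * set X * nat) * Y) :
    exists st', inv p.1 -> inv st' /\ next p.1 p.2 st'.
  case: p => -[[x U] n] y; rewrite /inv /next /=.
  have [[Uo Ux Kx UW]|nst] := pselect [/\ open U, U x, K x & U `<=` W];
    last by exists (x, U, n) => /nst.
  have [x' [Ux' Kx' x'far x'near]] : exists x', [/\ U x', K x',
      eta <= dY y (f x) -> x' = x &
      dY y (f x) < eta -> delta <= dY (f x) (f x')].
    have [far|near] := leP eta (dY y (f x)).
      by exists x; split=> //.
    have [z [Uz Kz zfar]] := oscW x U (UW _ Ux) Kx Uo Ux.
    by exists z; split.
  have n0 : 0 < n.+1%:R^-1 :> R by rewrite invr_gt0.
  have [V [Vo Vx' clV diamV]] := small_open_nbhs dX_metric dX_open Uo Ux' n0.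
  exists (x', V, n.+1) => _; split; split=> //=.
  by move=> z /subset_closure /clV /UW.
have {nextE} [step stepP] := choice nextE.
pose play (s : partial_play f) :=
  foldl (fun st y => step (st, set_val y)) (x0, W, 0%N) s.
have play_rcons s y : play (rcons s y) = step (play s, set_val y).
  by rewrite /play foldl_rcons.
have playP s : inv (play s).
  elim/last_ind: s => [|s y IH]; first by rewrite /inv /=; split.
  by rewrite play_rcons; have [] := stepP (play s, set_val y) IH.
have nextP s y : next (play s) (set_val y) (play (rcons s y)).
  by rewrite play_rcons; have [_] := stepP (play s, set_val y) (playP s).
exists (fun s => (play s).1.2); split.
  split=> [s|s|s y].
  - by have [] := playP s.
  - by exists (play s).1.1; have [] := playP s.
  - by have [cl _ _ _ _] := nextP s y; move=> z /subset_closure /cl.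
move=> y; pose st n := play (mkseq y n).
have stS n : next (st n) (set_val (y n)) (st n.+1) by rewrite /st mkseqS; exact: nextP.
have st2 n : (st n).2 = n.
  by elim: n => [|n IH] //; have [_ _ -> _ _] := stS n; rewrite IH.
have diam n u v : (st n.+1).1.2 u -> (st n.+1).1.2 v -> dX u v < n.+1%:R^-1.
  by have [_ + _ _ _] := stS n; rewrite st2; apply.
have conv : open_seq_convergent (fun n => (st n).1.2).
  have [||x Kx xU] := compact_nested_open (A := fun n => (st n).1.2) K_compact.
  - by move=> n; have [] := stS n.
  - by move=> n; exists (st n).1.1; have [] := playP (mkseq y n).
  exists x; split=> //.
  - by move=> n; have [] := playP (mkseq y n).
  - by move=> n; have [cl _ _ _ _] := stS n; move=> z /subset_closure /cl.
  - move=> V Vo Vx; have [e e0 eV] := (dX_open V).1 Vo x Vx.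
    have [n] := ltr_add_invr e0; rewrite add0r => ne.
    exists n.+1 => z Uz; apply: eV; apply: lt_trans ne; exact: diam.
case=> [/(_ conv)//|[x [[_ _ xU _] yx]]].
(* A guess that is never revised after round [N] is the limit. *)
have stable N : (forall n, (N <= n)%N -> (st n).1.1 = (st N).1.1) -> (st N).1.1 = x.
  move=> sN; apply: (is_metric_lt_inv_eq dX_metric) => n.
  have Nn : (N <= (N + n).+1)%N by rewrite leqW// leq_addr.
  apply: (@lt_le_trans _ _ (N + n).+1%:R^-1).
    apply: diam; last exact: xU.
    by rewrite -(sN _ Nn); have [] := playP (mkseq y (N + n).+1).
  by rewrite lef_pV2 ?posrE// ler_nat ltnS leq_addl.
have fx_nbhs : nbhs (f x) [set z | dY (f x) z < eta].
  by apply/(nbhs_is_metricP dY_metric dY_open); exists eta.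
have [N _ yN] := yx _ fx_nbhs.
(* Once the image of the guess is this far from [f x], the answers, which are
   within [eta] of [f x], no longer cause a revision. *)
pose far n := 2 * eta <= dY (f x) (f (st n).1.1).
have far_keep n : (N <= n)%N -> far n -> (st n.+1).1.1 = (st n).1.1.
  move=> Nn farn; have [_ _ _ keep _] := stS n; apply: keep.
  have := is_metric_triangle dY_metric (set_val (y n)) (f x) (f (st n).1.1).
  by move: farn (yN n Nn); rewrite /far /=; lra.
(* Hence such a guess would be the limit [x] itself. *)
have far_absurd n : (N <= n)%N -> ~ far n.
  move=> Nn farn.
  have E k : (st (n + k)%N).1.1 = (st n).1.1.
    elim: k => [|k IH]; first by rewrite addn0.
    rewrite addnS far_keep ?IH// ?(leq_trans Nn) ?leq_addr//.
    by rewrite /far IH.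
  have xE : (st n).1.1 = x.
    by apply: stable => m /subnKC <-; rewrite E.
  by move: farn; rewrite /far xE (is_metric_refl dY_metric); lra.
(* A revision from round [N] on would produce such a guess. *)
have keep n : (N <= n)%N -> (st n.+1).1.1 = (st n).1.1.
  move=> Nn; have [_ _ _ keep move_] := stS n; apply: keep.
  rewrite leNgt; apply/negP => near; apply: (@far_absurd n.+1); first exact: leqW.
  have := move_ near; move: near (yN n Nn); rewrite /far /= deltaE.
  have := is_metric_triangle dY_metric (f x) (f (st n).1.1) (f (st n.+1).1.1).
  have := is_metric_triangle dY_metric (set_val (y n)) (f (st n).1.1) (f x).
  rewrite (is_metric_sym dY_metric (f (st n).1.1) (set_val (y n))).
  rewrite (is_metric_sym dY_metric (set_val (y n)) (f x)); lra.
have xE : (st N).1.1 = x.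
  apply: stable => n /subnKC <-; elim: (n - N)%N => [|k IH]; first by rewrite addn0.
  by rewrite addnS keep ?leq_addr.
(* So [x] is the guess in round [N]; but the answer of round [N] is close to
   its image, which forces a revision. *)
apply: (@far_absurd N.+1) => //.
have [_ _ _ _] := stS N; rewrite xE (is_metric_sym dY_metric) => /(_ (yN N (leqnn N))).
by rewrite /far deltaE; move: eta0; lra.
Qed.

End CompactToStrategy.

(** * From a winning strategy to a compact set without continuity points *)

Section StrategyToCompact.
Context {R : realType} {X Y : topologicalType}.
Context {dX : X -> X -> R} {dY : Y -> Y -> R}.
Hypothesis dX_metric : is_metric dX.
Hypothesis dX_open : forall A : set X, open A <->
  (forall x, A x -> exists2 e : R, 0 < e & [set y | dX x y < e] `<=` A).
Hypothesis dY_metric : is_metric dY.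
Hypothesis dY_open : forall A : set Y, open A <->
  (forall x, A x -> exists2 e : R, 0 < e & [set y | dY x y < e] `<=` A).
Hypothesis X_separable : separable X.
Hypothesis Y_separable : separable Y.
Variable f : X -> Y.

(** Any two points of the image of [A] under [f] are at distance less than
    [e]. *)
Definition small_image (e : R) (A : set X) : Prop :=
  forall u v, A u -> A v -> dY (f u) (f v) < e.

(** [A] is covered by countably many closed sets whose images are small in the
    above sense.  For a closed set [A], having such covers for all [e > 0]
    amounts to the preimages of open sets under the restriction of [f] to [A]
    being F-sigma, that is, to this restriction being of the first Baire
    class. *)
Definition countably_small (e : R) (A : set X) : Prop :=
  exists F : nat -> set X,
    (forall i, closed (F i) /\ small_image e (F i)) /\ A `<=` \bigcup_i F i.

Lemma small_countably_small e A :
  closed A -> small_image e A -> countably_small e A.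
Proof. by move=> Ac As; exists (fun=> A); split=> // x Ax; exists 0%N. Qed.

Lemma countably_smallS e A B :
  A `<=` B -> countably_small e B -> countably_small e A.
Proof. by move=> AB [F [FP BF]]; exists F; split=> // x /AB /BF. Qed.

Lemma countably_small_bigcup e (A : nat -> set X) :
  (forall n, countably_small e (A n)) -> countably_small e (\bigcup_n A n).
Proof.
move=> /choice [F FP].
pose ij n : nat * nat := odflt (0, 0)%N (unpickle n).
exists (fun n => F (ij n).1 (ij n).2); split; first by move=> n; exact: (FP _).1.
move=> x [n _ /((FP n).2 x) [i _ Fx]].
by exists (pickle (n, i)); rewrite // /ij pickleK.
Qed.

Lemma countably_smallU e A B : countably_small e A -> countably_small e B ->
  countably_small e (A `|` B).
Proof.
move=> As Bs.
apply: (@countably_smallS _ _ (\bigcup_n (if n == 0%N then A else B))).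
  by move=> x [Ax|Bx]; [exists 0%N|exists 1%N].
by apply: countably_small_bigcup => n; case: ifP.
Qed.

(** The Cantor-Bendixson argument: the part of [K] without a countable cover
    by small pieces is compact, and around a continuity point of the
    restriction of [f] to it such a cover exists after all. *)
Lemma compact_countably_small (K : set X) (e : R) : compact K -> 0 < e ->
  (forall P : set X, P `<=` K -> P !=set0 -> compact P ->
    exists x, restriction_continuity_point f P x) ->
  countably_small e K.
Proof.
move=> Kc e0 cont.
have [B [Bo Bbase]] := separable_countable_base dX_metric dX_open X_separable.
pose good n := countably_small e (K `&` closure (B n)).
have goodU : countably_small e (\bigcup_(n in good) (K `&` closure (B n))).
  apply: (@countably_smallS _ _
    (\bigcup_n (if `[< good n >] then K `&` closure (B n) else set0))).
    by move=> x [n gn Kx]; exists n => //; rewrite asboolT.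
  apply: countably_small_bigcup => n; case: asboolP => // _.
  by apply: small_countably_small; [exact: closed0|move=> u v []].
pose P := K `\` \bigcup_(n in good) B n.
have PK : P `<=` K by move=> x [].
have Kcl : closed K by apply: compact_closed Kc; exact: is_metric_hausdorff dX_metric dX_open.
have Pcl : closed P.
  apply: closedI => //; apply: open_closedC; apply: bigcup_open => n _; exact: Bo.
have [P0|P0] := pselect (P !=set0); last first.
  apply: countably_smallS goodU => x Kx; apply: contrapT => nx; apply: P0.
  exists x; split=> // -[n gn Bx]; apply: nx; exists n => //; split=> //.
  exact: subset_closure.
have [x xcont] := cont P PK P0 (subclosed_compact Pcl Kc PK).
have /(restriction_continuity_pointP f P x dY_metric dY_open) [Px fx] := xcont.
have [V [Vo Vx VP]] := fx (e / 2) (divr_gt0 e0 (ltr0Sn R 1)).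
have [V' [V'o V'x clV' _]] := small_open_nbhs dX_metric dX_open Vo Vx ltr01.
have [n [Bx BV']] := Bbase x V' V'o V'x.
have BV : closure (B n) `<=` V by apply: subset_trans clV'; exact: closureS.
case: Px => Kx []; exists n => //.
apply: (@countably_smallS _ _ (P `&` closure (B n) `|`
  \bigcup_(n in good) (K `&` closure (B n)))).
  move=> z [Kz Bz]; have [[m gm Bmz]|nz] := pselect ((\bigcup_(n in good) B n) z).
    by right; exists m => //; split=> //; exact: subset_closure.
  by left.
apply: countably_smallU goodU; apply: small_countably_small.
  by apply: closedI => //; exact: closed_closure.
move=> u v [Pu /BV Vu] [Pv /BV Vv].
have := is_metric_triangle dY_metric (f x) (f u) (f v).
rewrite (is_metric_sym dY_metric (f u) (f x)).
have := VP u Vu Pu; have := VP v Vv Pv; lra.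
Qed.

(** Player II beats any play converging into a set with countable covers
    [F j] by closed pieces in whose images any two points are at distance less
    than [1/(j+1)].  The limit is
    guessed to lie in the first piece of [F j] that the set just played meets;
    each guess is eventually correct.  The answer in round [n] is one of the
    first [n+1] terms of the dense sequence [D], compatible with as many
    guesses as possible. *)
Lemma countably_small_reply (K : set X) (D : nat -> Y) :
  (forall e : R, 0 < e -> countably_small e K) ->
  (forall x (e : R), 0 < e -> exists n, dY (D n) (f x) < e) ->
  exists reply : nat -> set X -> nat, (forall n U, (reply n U <= n)%N) /\
    forall U x, K x -> open_seq_converges U x ->
      (fun n => D (reply n (U n))) @ \oo --> f x.
Proof.
move=> Ksmall Ddense.
have Ksmall_inv j : countably_small j.+1%:R^-1 K.
  by apply: Ksmall; rewrite invr_gt0.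
have [F FP] := choice Ksmall_inv.
pose meets j (U : set X) i := F j i `&` U !=set0.
have first_met (p : nat * set X) : exists i0, forall i, meets p.1 p.2 i ->
    meets p.1 p.2 i0 /\ (i0 <= i)%N.
  case: p => j U /=.
  have [[i0 Ui0]|nU] := pselect (exists i, meets j U i); last first.
    by exists 0%N => i Ui; case: nU; exists i.
  have ex : exists i, `[< meets j U i >] by exists i0; apply/asboolP.
  case: (ex_minnP ex) => m /asboolP Um mmin; exists m => i Ui.
  by split=> //; apply: mmin; apply/asboolP.
have [idx idxP] := choice first_met.
pose fits k U p := forall j, (j < k)%N ->
  exists z, F j (idx (j, U)) z /\ dY p (f z) < j.+1%:R^-1.
have best_fit (q : nat * set X) : exists m0, (m0 <= q.1)%N /\
    forall k m, (k <= q.1)%N -> (m <= q.1)%N ->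
      fits k q.2 (D m) -> fits k q.2 (D m0).
  case: q => n U /=.
  pose Q k := (k <= n)%N /\ exists m, (m <= n)%N /\ fits k U (D m).
  have exQ : exists k, `[< Q k >].
    by exists 0%N; apply/asboolP; split=> //; exists 0%N.
  have ubQ k : `[< Q k >] -> (k <= n)%N by move=> /asboolP [].
  case: (ex_maxnP exQ ubQ) => k /asboolP [kn [m [mn km]]] kmax.
  exists m; split=> // k' m' k'n m'n k'm' j jk'; apply: km.
  by apply: leq_trans jk' (kmax _ _); apply/asboolP; split=> //; exists m'.
have [reply replyP] := choice best_fit.
exists (fun n U => reply (n, U)); split=> [n U|U x Kx [Uo US Ux Ubase]].
  by have [] := replyP (n, U).
have Udec n m : (n <= m)%N -> U m `<=` U n.
  by move=> /subnK <-; elim: (m - n)%N => [//|k IH] z /US; exact: IH.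
(* The sets played eventually avoid the finitely many pieces of [F j] that come
   before a piece containing [x] but do not contain [x] themselves. *)
have idx_eventually j : \forall n \near \oo, F j (idx (j, U n)) x.
  have [_ /(_ x Kx) [i0 _ Fi0]] := FP j.
  pose V := ~` \bigcup_(i in [set i | (i < i0.+1)%N /\ ~ F j i x]) F j i.
  have Vo : open V.
    apply: closed_openC; apply: closed_bigcup => [|i _]; last exact: ((FP j).1 i).1.
    by apply: (@sub_finite_set _ _ `I_i0.+1) => [i []|]; last exact: finite_II.
  have Vx : V x by move=> [i [_ nFi]].
  have [N UV] := Ubase V Vo Vx.
  exists N => // n /= Nn; have meets0 : meets j (U n) i0 by exists x.
  have [[z [Fz Uz]] le0] := idxP (j, U n) i0 meets0.
  apply: contrapT => nF; apply: (UV z (Udec _ _ Nn _ Uz)).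
  by exists (idx (j, U n)).
move=> A /(nbhs_is_metricP dY_metric dY_open) [e e0 eA].
have [k] : exists k, 0 + k.+1%:R^-1 < e / 2 by apply: ltr_add_invr; rewrite divr_gt0.
rewrite add0r => ke.
have [m Dm] : exists m, dY (D m) (f x) < k.+1%:R^-1 by apply: Ddense; rewrite invr_gt0.
have : \forall n \near \oo, forall j : 'I_k.+1, F j (idx (nat_of_ord j, U n)) x.
  by apply: filter_forall => j; exact: idx_eventually.
move=> [N _ guess]; exists (maxn N (maxn k.+1 m)) => // n /=.
rewrite !geq_max => /and3P[Nn kn mn]; apply: eA => /=.
have /(proj2 (replyP (n, U n))) fit : fits k.+1 (U n) (D m).
  move=> j jk; exists x; split; first exact: guess n Nn (Ordinal jk).
  by apply: lt_le_trans Dm _; rewrite lef_pV2 ?posrE// ler_nat.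
have [z [Fz Dz]] := fit kn mn k (ltnSn k).
have Fx := guess n Nn ord_max.
have := (((FP k).1 _).2 x z Fx Fz); move: Dz ke.
rewrite (is_metric_sym dY_metric (D _)).
have := is_metric_triangle dY_metric (f z) (f x) (D (reply (n, U n))).
set s := k.+1%:R^-1; rewrite (is_metric_sym dY_metric (f z)); lra.
Qed.

(** The limits of the plays in which Player II answers in round [n] with one
    of the first [n+1] terms of the sequence [D] form a compact set. *)
Lemma strategy_compact_limits (tau : partial_play f -> set X)
    (D : nat -> set_type (range f)) :
  (forall y, open_seq_convergent (fun n => tau (mkseq y n))) ->
  exists2 g : (nat -> nat) -> X,
    (forall c, open_seq_converges (fun n => tau (mkseq (D \o c) n)) (g c)) &
    compact (g @` [set c | forall n, (c n <= n)%N]).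
Proof.
move=> conv; have [g gP] := choice (fun c => conv (D \o c)).
exists g => //.
pose C := [set c : prod_topology (fun _ : nat => nat) | forall n, `I_n.+1 (c n)].
have Cc : compact C.
  apply: (@tychonoff _ (fun _ : nat => nat) (fun i => `I_i.+1)) => n.
  exact: finite_compact (finite_II n.+1).
rewrite (_ : [set c | _] = C) //.
apply: (continuous_compact (f := g : prod_topology _ -> X)) Cc.
apply: continuous_subspaceT => c V; rewrite nbhsE => -[V' [V'o V'c] V'V].
have [_ _ _ /(_ V' V'o V'c) [n nV']] := gP c.
have cyl : nbhs c [set c' : prod_topology (fun _ : nat => nat) |
    forall i : 'I_n, c' (nat_of_ord i) = c (nat_of_ord i)].
  apply: (@filter_forall _ _ (fun i : 'I_n =>
    [set c' : prod_topology (fun _ : nat => nat) | c' (nat_of_ord i) = c i])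
    (nbhs c) (nbhs_filter c)) => i.
  exact: (@proj_continuous _ (fun _ : nat => nat) i c [set c i] (discrete_set1 (c i))).
apply: filterS cyl => c' cc'; apply: V'V; apply: nV'.
have -> : mkseq (D \o c) n = mkseq (D \o c') n.
  apply: (@eq_from_nth _ (D 0%N)); rewrite !size_mkseq// => i ilt.
  by rewrite !nth_mkseq//= (cc' (Ordinal ilt)).
by have [_ _ + _] := gP c'; apply.
Qed.

Lemma strategy_compact : playerI_has_winning_strategy f ->
  exists K : set X, [/\ K !=set0, compact K &
    forall x, ~ restriction_continuity_point f K x].
Proof.
move=> [tau [[tau_open tau_neq0 tau_dec] tau_win]].
have [B [Bo Bbase]] := separable_countable_base dY_metric dY_open Y_separable.
have [x0 _] := tau_neq0 [::].
have pick n : exists y : set_type (range f),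
    B n `&` range f !=set0 -> B n (set_val y).
  have [[y [By fy]]|nB] := pselect (B n `&` range f !=set0).
    by exists (exist _ y (mem_set fy)).
  by exists (exist _ (f x0) (mem_set (imageT f x0))) => /nB.
have [D DB] := choice pick.
have Ddense x (e : R) : 0 < e -> exists n, dY (set_val (D n)) (f x) < e.
  move=> e0; have fx : [set y | dY (f x) y < e] (f x).
    by rewrite /= (is_metric_refl dY_metric).
  have [n [Bfx Be]] := Bbase _ _ (open_is_metric_ball dY_metric dY_open _ _) fx.
  exists n; rewrite (is_metric_sym dY_metric); apply: Be; apply: DB.
  by exists (f x); split.
have conv y : open_seq_convergent (fun n => tau (mkseq y n)).
  by apply: contrapT => nconv; apply: (tau_win y); left.
have [g gP Kc] := strategy_compact_limits D conv.
set C := [set c | _] in Kc; set K := g @` C in Kc.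
apply: contrapT => noK.
have Ksmall (e : R) : 0 < e -> countably_small e K.
  move=> e0; apply: compact_countably_small => // P _ P0 Pc.
  apply: contrapT => nP; apply: noK; exists P; split=> // x Px.
  by apply: nP; exists x.
have [reply [replyn reply_cvg]] := countably_small_reply Ksmall Ddense.
pose hist := fix hist n : seq nat := if n is m.+1
  then rcons (hist m) (reply m (tau (map D (hist m)))) else [::].
pose c n := reply n (tau (map D (hist n))).
have histE n : map D (hist n) = mkseq (D \o c) n.
  by elim: n => [//|n IH]; rewrite mkseqS -IH /= map_rcons.
apply: (tau_win (D \o c)); right; exists (g c); split; first exact: gP.
have Kgc : K (g c) by exists c => // n; exact: replyn.
have -> : (fun n => set_val ((D \o c) n)) =
    (fun n => set_val (D (reply n (tau (mkseq (D \o c) n))))).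
  by apply/funext => n; rewrite -histE.
exact: reply_cvg.
Qed.

End StrategyToCompact.

Theorem theorem2p3 (R : realType) (X Y : topologicalType)
  (X_metrizable : metrizable R X) (X_separable : separable X)
  (Y_metrizable : metrizable R Y) (Y_separable : separable Y)
  (f : X -> Y) :
  playerI_has_winning_strategy f <->
  exists K : set X,
    [/\ K !=set0, compact K & forall x : X, ~ restriction_continuity_point f K x].
Proof.
have [dX dX_metric dX_open] := X_metrizable.
have [dY dY_metric dY_open] := Y_metrizable.
split=> [|[K [K0 Kc Kdisc]]].
  exact: (strategy_compact dX_metric dX_open dY_metric dY_open).
exact: (compact_winning_strategy dX_metric dX_open dY_metric dY_open Kc K0 Kdisc).
Qed.
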